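(* Let $\vec U=(\vec U,\le,{}^*,\vee,\wedge,|\ |)$ be a finite submodular universe of separations. Then for every robust set $\mathcal P$ of profiles in $\vec U$ there is a nested set $T=T(\mathcal P)\subseteq U$ of separations such that: (i) every two profiles in $\mathcal P$ are efficiently distinguished by some separation in $T$; (ii) every separation in $T$ efficiently distinguishes a pair of profiles in $\mathcal P$; (iii) for every automorphism $\alpha$ of $\vec U$ we have $T(\mathcal P^\alpha)=T(\mathcal P)^\alpha$; (iv) if all the profiles in $\mathcal P$ are regular, then $T$ is a regular tree set. (Here $\mathcal P\mapsto T(\mathcal P)$ is a single map defined on all robust sets $\mathcal P$ of profiles in $\vec U$.)
   Context: A separation system $(\vec S,\le,{}^* )$ is a partially ordered set $\vec S$ with an order-reversing involution $^*$. Its elements $\vec s$ are oriented separations, $\vec s^{\,*}$ is the inverse of $\vec s$, and $s=\{\vec s,\vec s^{\,*}\}$ is the corresponding (unoriented) separation with orientations $\vec s,\vec s^{\,*}$; $S$ denotes the set of all these $s$, and for $R\subseteq S$, $\vec R$ is the set of all orientations of elements of $R$. $\vec s$ (and $s$) is degenerate if $\vec s=\vec s^{\,*}$; $\vec s$ is small if $\vec s\le\vec s^{\,*}$; $\vec r\in\vec S$ is trivial in $\vec S$ if there is $s\in S$ with $\vec r<\vec s$ and $\vec r<\vec s^{\,*}$. A universe of separations is a separation system $\vec U$ with binary operations $\vee,\wedge$ giving suprema and infima. It is submodular if it comes with an order function $\vec s\mapsto|\vec s|\in\mathbb R$ satisfying $0\le|\vec s|=|\vec s^{\,*}|=:|s|$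 and $|\vec r\vee\vec s|+|\vec r\wedge\vec s|\le|\vec r|+|\vec s|$ for all $\vec r,\vec s\in\vec U$. An automorphism of $\vec U$ is a bijection $\vec U\to\vec U$ respecting the ordering (in both directions) and commuting with $^*$ and the order function; write $\vec s^{\,\alpha}$ for the image, $s^\alpha=\{\vec s^{\,\alpha},(\vec s^{\,*})^\alpha\}$, and use $T^\alpha$, $P^\alpha$, $\mathcal P^\alpha=\{P^\alpha:P\in\mathcal P\}$ for images of sets. Separations $r,s$ are nested if they have comparable orientations; a set of separations is nested if every two elements are. A tree set is a set $T$ of separations that is nested and such that $\vec T$ has no element that is degenerate or trivial in $\vec T$; it is regular if no element of $\vec T$ is small. For $k>0$ put $\vec S_k=\{\vec s\in\vec U:|\vec s|<k\}$. An orientation of a separation system $\vec S$ is a set $O\subseteq\vec S$ with $O\cup O^*=\vec S$ and $|O\cap\{\vec s,\vec s^{\,*}\}|=1$ for all $s\in S$. It is consistent if there are no distinct $r,s\in S$ with orientations $\vec r<\vec s$ such that $\vec r^{\,*},\vec s\in O$. For $\vec S\subseteq\vec U$, a profile of $S$ is a consistent orientation $P$ of $S$ such that $(\vec r\vee\vec s)^*\notin P$ for all $\vec r,\vec s\in P$. It is regular if it contains no separation whose inverse is small. A $k$-profile in $\vec U$, for an integer $k>0$, is a profile of $S_k$; a profile in $\vec U$ is a $k$-profile in $\vec U$ for some $k$. A non-degenerate $s\in U$ distinguishes profiles $P,P'$ if it has an orientation $\vec s\in P$ with $\vec s^{\,*}\in P'$. $P,P'$ are distinguishable if some $s\in U$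 distinguishes them; $\kappa(P,P')$ is then the smallest order of such an $s$, and $s$ distinguishes $P,P'$ efficiently if it distinguishes them and $|s|=\kappa(P,P')$. A profile $P$ is $n$-robust if for every $\vec r\in P$ and every $s\in S_n$ (i.e. $|s|<n$): if $\vec r^{\,*}\wedge\vec s$ and $\vec r^{\,*}\wedge\vec s^{\,*}$ both have order $<|r|$, they do not both lie in $P$. Two profiles $P,P'$ in $\vec U$ are $n$-robustly distinguishable if they are distinguishable and the distinct profiles $P\cap\vec S_k$ and $P'\cap\vec S_k$ they induce for $k=\kappa(P,P')+1$ are both $n$-robust. A set $\mathcal P$ of profiles in $\vec U$ is $n$-robust if any distinct $P,P'\in\mathcal P$ are $n$-robustly distinguishable and satisfy $\kappa(P,P')<n$. A set $\mathcal P$ of pairwise distinguishable profiles is robust if it is $n$-robust for $n=\max\{\kappa(P,P'):P,P'\in\mathcal P\text{ distinct}\}+1$ (sets with at most one element count as robust). *)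

(* Defs.v *)
From HB Require Import structures.
From mathcomp Require Import all_boot all_order all_algebra.
From mathcomp Require Import reals.

Set Implicit Arguments.
Unset Strict Implicit.
Unset Printing Implicit Defensive.

Import Order.TTheory GRing.Theory Num.Theory.

Local Open Scope order_scope.

HB.mixin Record isSeparationSystem (d : Order.disp_t) S of Order.POrder d S := {
  sinv : S -> S;
  sinvK : involutive sinv;
  sinv_le : forall x y : S, x <= y -> sinv y <= sinv x
}.

#[short(type="sepSystemType")]
HB.structure Definition SepSystem (d : Order.disp_t) :=
  { S of isSeparationSystem d S & Order.POrder d S }.

#[short(type="finUniverseType")]
HB.structure Definition FinUniverse (d : Order.disp_t) :=
  { U of isSeparationSystem d U & Order.FinLattice d U }.

HB.mixin Record isSubmodularUniverse (R : realType) (d : Order.disp_t) U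
    of FinUniverse d U := {
  sord : U -> R;
  sord_ge0 : forall s : U, (0 <= sord s)%R;
  sord_sinv : forall s : U, sord (sinv s) = sord s;
  sord_submodular : forall r s : U,
    (sord (r `|` s) + sord (r `&` s) <= sord r + sord s)%R
}.

#[short(type="finSubmodUniverseType")]
HB.structure Definition FinSubmodUniverse (R : realType) (d : Order.disp_t) :=
  { U of isSubmodularUniverse R d U & FinUniverse d U }.

Section Separations.
Context (R : realType) (d : Order.disp_t) (U : finSubmodUniverseType R d).

(* Elements of U are oriented separations.  An unoriented separation is the
   set of its orientations, so a set of separations T is a set of sets of
   elements of U, and cover T is the set of all orientations of elements of T. *)
Implicit Types (r s : U) (t : {set U}) (S O P : {set U}).
Implicit Types (T : {set {set U}}) (Ps : {set {set U}}).

Local Notation inv := (@sinv d U).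

Definition sep s : {set U} := [set s; inv s].

Definition separations : {set {set U}} := [set sep s | s : U].

(* The choice of the orientation is immaterial, by sord_sinv. *)
Definition sep_ord t : R := if [pick s in t] is Some s then sord s else 0%R.

Definition degenerate s : bool := s == inv s.
Definition small s : bool := s <= inv s.
Definition trivial_in S r : bool := [exists s in S, (r < s) && (r < inv s)].

Definition nested_seps t t' : bool :=
  [exists s in t, exists s' in t', s >=< s'].
Definition nested T : bool :=
  [forall t in T, forall t' in T, nested_seps t t'].

Definition tree_set T : bool :=
  [&& T \subset separations, nested T
    & [forall s in cover T, ~~ degenerate s && ~~ trivial_in (cover T) s]].
Definition regular_tree_set T : bool :=
  tree_set T && [forall s in cover T, ~~ small s].

Definition Sk (k : R) : {set U} := [set s | (sord s < k)%R].

Definition orientation S O : bool :=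
  [&& O \subset S, O :|: inv @: O == S
    & [forall s in S, #|O :&: sep s| == 1]].

Definition consistent S O : bool :=
  ~~ [exists r in S, exists s in S,
       [&& sep r != sep s, r < s, inv r \in O & s \in O]].

Definition profile_of S P : bool :=
  [&& orientation S P, consistent S P
    & [forall r in P, forall s in P, inv (r `|` s) \notin P]].

Definition k_profile (k : nat) P : bool := (0 < k)%N && profile_of (Sk k%:R) P.
Definition profile P : Prop := exists k : nat, k_profile k P.

Definition regular_profile P : bool := [forall s in P, ~~ small (inv s)].

Definition distinguishes t P P' : bool :=
  (t \in separations) &&
  [exists s in t, [&& ~~ degenerate s, s \in P & inv s \in P']].

Definition distinguishable P P' : bool :=
  [exists t : {set U}, distinguishes t P P'].

(* The value 0 for indistinguishable P and P' is a dummy. *)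
Definition kappa P P' : R :=
  if [pick t | distinguishes t P P'] is Some t0
  then sep_ord [arg min_(t < t0 | distinguishes t P P') sep_ord t]
  else 0%R.

Definition efficiently_distinguishes t P P' : bool :=
  distinguishes t P P' && (sep_ord t == kappa P P').

Definition robust_profile (n : R) P : Prop :=
  forall r s, r \in P -> s \in Sk n ->
    (sord (inv r `&` s) < sord r)%R ->
    (sord (inv r `&` inv s) < sord r)%R ->
    ~ (inv r `&` s \in P /\ inv r `&` inv s \in P).

Definition robustly_distinguishable (n : R) P P' : Prop :=
  let k := (kappa P P' + 1)%R in
  [/\ distinguishable P P', robust_profile n (P :&: Sk k)
    & robust_profile n (P' :&: Sk k)].

Definition n_robust_set (n : R) Ps : Prop :=
  forall P P', P \in Ps -> P' \in Ps -> P != P' ->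
    robustly_distinguishable n P P' /\ (kappa P P' < n)%R.

(* The default 0 of the maximum only matters if Ps has at most one element,
   since kappa is nonnegative; n_robust_set is then vacuous. *)
Definition max_kappa Ps : R :=
  \big[Num.max/0%R]_(X in setX Ps Ps | X.1 != X.2) kappa X.1 X.2.

Definition robust_set_of_profiles Ps : Prop :=
  [/\ forall P, P \in Ps -> profile P,
      forall P P', P \in Ps -> P' \in Ps -> P != P' -> distinguishable P P'
    & n_robust_set (max_kappa Ps + 1)%R Ps].

Definition automorphism (a : U -> U) : Prop :=
  [/\ bijective a, forall r s, (a r <= a s) = (r <= s),
      forall s, a (inv s) = inv (a s) & forall s, sord (a s) = sord s].

(* The image under a both of a set of profiles and of a set of separations. *)
Definition image_family (a : U -> U) (F : {set {set U}}) : {set {set U}} :=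
  [set a @: (X : {set U}) | X in F].

End Separations.

Arguments separations {R d} U.

(* Main.v *)
Require Import Defs.
From mathcomp Require Import all_boot all_order all_algebra.
From mathcomp Require Import reals.
From mathcomp Require Import lra.

(** The set T is built in layers, one for each order k of separations, in
increasing order.  Let A be the set obtained before order k.  For each pair
P, P' of profiles with kappa P P' = k, the candidates are the separations that
distinguish P and P' efficiently and are nested with A.  Let N be the set of
all candidates for all pairs with kappa equal to k.  For each pair the layer
receives all those candidates that cross the fewest elements of N.  No choice
is made, so the construction commutes with automorphisms; there remain two
things to prove.

- Every pair has a candidate (candidates_nonempty).  Among the efficient
  distinguishers t of P, P' take one crossing as few elements of A as possible.
  If it crosses some s in A, then s has lower order, so P and P' contain the
  same orientation of s.  Unless one of the two corners of s and t on that side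
  of s has order at most that of t, submodularity makes both corners on the
  other side of s have lower order than s.  Two profiles in the set are
  efficiently distinguished by s, and this contradicts the robustness of the
  one that lives on this other side (robust_corner).  A corner of small order
  distinguishes P and P' efficiently, is nested with s and, by the fish lemma
  nested_with_join, is nested with every element of A that is nested with t,
  contrary to the choice of t.

- The new layer is nested (new_layer_nested).  If s, selected for P, P', crosses
  t, selected for Q, Q', both of order k, then two opposite corners of s and t
  can replace s and t as candidates, or both corners can replace s while s and t
  cross equally many elements of N (opposite_corners).  Crossing numbers are
  strictly submodular on crossing separations (crossing_number_submodular), so
  one of the corners crosses fewer elements of N than the separation that it
  replaces.

If all the profiles are regular, then no orientation of a separation that
distinguishes two of them is small, hence none is degenerate or trivial.

An unoriented separation is handled through an arbitrary orientation s; being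
nested, the order and what is distinguished depend only on sep s. *)

Set Implicit Arguments.
Unset Strict Implicit.
Unset Printing Implicit Defensive.

Import Order.TTheory GRing.Theory Num.Theory.

Local Open Scope order_scope.

(** * The involution *)

Section TreeOfProfiles.
Context (R : realType) (d : Order.disp_t) (U : finSubmodUniverseType R d).
Implicit Types (r s t u : U) (A N P Q : {set U}) (Ps : {set {set U}}).

Local Notation inv := (@sinv d U).

Lemma sinv_inj : injective inv.
Proof. exact: can_inj sinvK. Qed.

Lemma sinv_leE s t : (inv s <= inv t) = (t <= s).
Proof.
apply/idP/idP => [/sinv_le|]; last exact: sinv_le.
by rewrite !sinvK.
Qed.

Lemma sinv_join s t : inv (s `|` t) = inv s `&` inv t.
Proof.
apply/le_anti/andP; split; first by rewrite lexI !sinv_le ?leUl ?leUr.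
rewrite -[leLHS]sinvK; apply: sinv_le.
by rewrite leUx -{1}[s]sinvK -{2}[t]sinvK !sinv_le ?leIl ?leIr.
Qed.

Lemma sinv_meet s t : inv (s `&` t) = inv s `|` inv t.
Proof. by apply/sinv_inj; rewrite sinv_join !sinvK. Qed.

Lemma sep_inv s : sep (inv s) = sep s.
Proof. by rewrite /sep sinvK setUC. Qed.

Lemma sep_eqP s t : reflect (s = t \/ s = inv t) (sep s == sep t).
Proof.
apply: (iffP eqP) => [E|[->//|->]]; last by rewrite sep_inv.
have : s \in sep t by rewrite -E !inE eqxx.
by rewrite !inE => /orP[] /eqP; [left|right].
Qed.

Lemma sep_ord_sep s : sep_ord (sep s) = sord s.
Proof.
rewrite /sep_ord; case: pickP => [x|/(_ s)]; rewrite !inE ?eqxx //.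
by case/orP => /eqP ->; rewrite ?sord_sinv.
Qed.

Lemma degenerate_inv s : degenerate (inv s) = degenerate s.
Proof. by rewrite /degenerate sinvK eq_sym. Qed.

(** * Crossing separations and their corners *)

Definition nested_with s t : bool := nested_seps (sep s) (sep t).

Lemma nested_withP s t :
  reflect (exists2 u, sep u = sep t & (s <= u) || (u <= s)) (nested_with s t).
Proof.
apply: (iffP exists_inP) => [[x xs /exists_inP[y yt c]]|[u ut c]].
  have Ey : sep y = sep t by move: yt; rewrite !inE => /orP[]/eqP->; rewrite ?sep_inv.
  move: xs; rewrite !inE => /orP[]/eqP E; first by exists y; rewrite -?E.
  exists (inv y); first by rewrite sep_inv.
  by rewrite -[s]sinvK -E !sinv_leE orbC.
exists s; first by rewrite !inE eqxx.
by apply/exists_inP; exists u; rewrite // -ut !inE eqxx.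
Qed.

Lemma nested_with_sym s t : nested_with s t = nested_with t s.
Proof.
by apply/exists_inP/exists_inP => -[x ? /exists_inP[y ? c]];
  exists y => //; apply/exists_inP; exists x; rewrite // comparable_sym.
Qed.

Lemma nested_with_refl s : nested_with s s.
Proof. by apply/nested_withP; exists s; rewrite ?lexx. Qed.

Lemma nested_with_sepr s t t' : sep t = sep t' -> nested_with s t = nested_with s t'.
Proof. by rewrite /nested_with => ->. Qed.

Lemma nested_with_sepl s s' t : sep s = sep s' -> nested_with s t = nested_with s' t.
Proof. by rewrite /nested_with => ->. Qed.

Lemma le_nested_with s t : s <= t -> nested_with s t.
Proof. by move=> st; apply/nested_withP; exists t; rewrite ?st. Qed.

Lemma ge_nested_with s t : t <= s -> nested_with s t.
Proof. by move=> ts; apply/nested_withP; exists t; rewrite ?ts ?orbT. Qed.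

(** The fish lemma.  If no orientation of u lies below s or below t, then s and
t both lie below orientations of u, and below the same one because s and t
cross. *)
Lemma nested_with_join u s t :
  nested_with u s -> nested_with u t -> ~~ nested_with s t ->
  nested_with u (s `|` t).
Proof.
rewrite ![nested_with u _]nested_with_sym => /nested_withP[v vu c1] /nested_withP[w wu c2] st.
have [vs|] := boolP (v <= s).
  by rewrite -(nested_with_sepr _ vu) ge_nested_with // lexU2 ?vs.
have [wt|] := boolP (w <= t).
  by rewrite -(nested_with_sepr _ wu) ge_nested_with // lexU2 ?wt ?orbT.
move: c1 c2 => /orP[sv|->//] /orP[tw|->//] _ _.
have /sep_eqP[E|E] : sep w == sep v by rewrite wu vu.
  by rewrite -(nested_with_sepr _ vu) le_nested_with // leUx sv -E tw.
case/negP: st; rewrite -(nested_with_sepr _ (sep_inv t)) le_nested_with //.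
by rewrite (le_trans sv) // -sinv_leE sinvK -E.
Qed.

Lemma nested_with_meet u s t :
  nested_with u s -> nested_with u t -> ~~ nested_with s t ->
  nested_with u (s `&` t).
Proof.
move=> us ut st; rewrite -(nested_with_sepr _ (sep_inv _)) sinv_meet nested_with_join //.
- by rewrite (nested_with_sepr _ (sep_inv _)).
- by rewrite (nested_with_sepr _ (sep_inv _)).
by rewrite (nested_with_sepr _ (sep_inv _)) (nested_with_sepl _ (sep_inv _)).
Qed.

(** Below t an orientation of u is below the join, above t it is above the
meet. *)
Lemma nested_with_join_or_meet u s t :
  nested_with u t -> nested_with u (s `|` t) || nested_with u (s `&` t).
Proof.
rewrite nested_with_sym => /nested_withP[v vu /orP[tv|vt]]; apply/orP; [right|left];
  rewrite nested_with_sym -(nested_with_sepr _ vu).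
  by rewrite le_nested_with // (le_trans (leIr _ _)).
by rewrite ge_nested_with // (le_trans vt) // leUr.
Qed.

Definition crossing_number N s : nat := #|[set u in N | ~~ nested_with u s]|.

Lemma crossing_numberE N s : crossing_number N s = \sum_(u in N) ~~ nested_with u s.
Proof.
rewrite /crossing_number -sum1dep_card big_mkcondr /=.
by apply: eq_bigr => u _; case: nested_with.
Qed.

Lemma crossing_number_sep N s t :
  sep s = sep t -> crossing_number N s = crossing_number N t.
Proof.
move=> E; rewrite !crossing_numberE; apply: eq_bigr => u _.
by rewrite (nested_with_sepr _ E).
Qed.

(** Each u in N crosses the two corners together at most as often as it crosses
s and t together.  The inequality is strict at u = s, which crosses t but is
nested with both corners. *)
Lemma crossing_number_submodular N s t : s \in N -> ~~ nested_with s t ->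
  (crossing_number N (s `|` t) + crossing_number N (s `&` t)
   < crossing_number N s + crossing_number N t)%N.
Proof.
move=> sN st; rewrite !crossing_numberE -!big_split /=.
rewrite (bigD1 s) //= [ltnRHS](bigD1 s) //=.
rewrite nested_with_refl st le_nested_with ?leUl // ge_nested_with ?leIl //= !add0n add1n ltnS.
apply: leq_sum => u _.
have [us|us] := boolP (nested_with u s); have [ut|ut] := boolP (nested_with u t).
- by rewrite nested_with_join ?nested_with_meet.
- rewrite joinC meetC; case/orP: (nested_with_join_or_meet t us) => ->;
    by case: nested_with.
- by case/orP: (nested_with_join_or_meet s ut) => ->; case: nested_with.
- by do 2!case: nested_with.
Qed.

(** * Profiles and the separations distinguishing them *)

(** This is distinguishes (sep s) P Q, see distinguishes_sep. *)
Definition dist s P Q : bool :=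
  ~~ degenerate s && ((s \in P) && (inv s \in Q) || (inv s \in P) && (s \in Q)).

Definition efficient s P Q : bool :=
  dist s P Q && [forall s', dist s' P Q ==> (sord s <= sord s')%R].

Lemma distinguishes_sep s P Q : distinguishes (sep s) P Q = dist s P Q.
Proof.
rewrite /distinguishes imset_f //= /dist.
apply/exists_inP/andP => [[x]|[dg]].
  rewrite !inE => /orP[]/eqP-> /and3P[dg xP xQ].
    by rewrite dg xP xQ.
  by rewrite sinvK in xQ; rewrite -degenerate_inv dg xP xQ orbT.
case/orP => /andP[xP xQ]; [exists s|exists (inv s)];
  by rewrite ?inE ?eqxx ?orbT ?sinvK ?degenerate_inv ?dg ?xP.
Qed.

Lemma distinguishes_isSep X P Q : distinguishes X P Q -> exists s, X = sep s.
Proof. by case/andP => /imsetP[s _ ->] _; exists s. Qed.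

Lemma efficientP s P Q :
  reflect (dist s P Q /\ forall s', dist s' P Q -> (sord s <= sord s')%R)
          (efficient s P Q).
Proof.
apply: (iffP andP) => -[ds /= H]; split=> //.
  by move=> s'; apply/implyP/(forallP H).
by apply/forallP => s'; apply/implyP/H.
Qed.

Lemma kappaE s P Q : efficient s P Q -> kappa P Q = sord s.
Proof.
case/efficientP => ds mins; rewrite /kappa; case: pickP => [X0 X0d|/(_ (sep s))]; last first.
  by rewrite distinguishes_sep ds.
case: arg_minP => // X Xd Xmin; apply/le_anti.
rewrite -[leRHS]sep_ord_sep Xmin ?distinguishes_sep //=.
have [x E] := distinguishes_isSep Xd.
by rewrite E sep_ord_sep mins // -distinguishes_sep -E.
Qed.

Lemma efficient_exists P Q : distinguishable P Q -> exists s, efficient s P Q.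
Proof.
case/existsP => X Xd; have [x E] := distinguishes_isSep Xd.
rewrite {}E distinguishes_sep in Xd.
case: (@arg_minP _ _ _ x (fun s => dist s P Q) (fun s => sord s) Xd) => s ds mins.
by exists s; apply/efficientP.
Qed.

Lemma efficient_efficiently_distinguishes s P Q :
  efficient s P Q -> efficiently_distinguishes (sep s) P Q.
Proof.
move=> es; rewrite /efficiently_distinguishes (kappaE es) sep_ord_sep eqxx.
by rewrite distinguishes_sep andbT; case/efficientP: es.
Qed.

Lemma dist_inv s P Q : dist (inv s) P Q = dist s P Q.
Proof. by rewrite -!distinguishes_sep sep_inv. Qed.

Lemma dist_sym s P Q : dist s P Q = dist s Q P.
Proof. by rewrite /dist orbC ![(_ \in P) && _]andbC. Qed.

Lemma sord_sep s t : sep s = sep t -> sord s = sord t.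
Proof. by move=> E; rewrite -sep_ord_sep E sep_ord_sep. Qed.

Lemma efficient_sep s t P Q : sep s = sep t -> efficient s P Q = efficient t P Q.
Proof. by move=> E; rewrite /efficient -!distinguishes_sep E (sord_sep E). Qed.

Lemma efficient_inv s P Q : efficient (inv s) P Q = efficient s P Q.
Proof. exact: efficient_sep (sep_inv s). Qed.

Lemma efficient_sym s P Q : efficient s P Q = efficient s Q P.
Proof. by rewrite /efficient dist_sym; under eq_forallb do rewrite dist_sym. Qed.

Lemma efficient_of_dist s t P Q :
  efficient s P Q -> dist t P Q -> (sord t <= sord s)%R -> efficient t P Q.
Proof.
case/efficientP => _ mins dt ts; apply/efficientP; split=> // u /mins.
exact: le_trans.
Qed.

Lemma distI s P Q : s \in P -> inv s \in Q -> inv s \notin P -> dist s P Q.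
Proof.
move=> sP sQ sNP; rewrite /dist sP sQ /= andbT.
by apply: contra sNP => /eqP <-.
Qed.

Section Profile.
Variable P : {set U}.
Hypothesis profP : profile P.

Lemma profile_orients r s :
  r \in P -> (sord s <= sord r)%R -> (s \in P) || (inv s \in P).
Proof.
case: profP => k /andP[_ /and3P[/and3P[/subsetP sub /eqP E _] _ _]] rP sr.
have : s \in Sk U k%:R.
  by have := sub _ rP; rewrite !inE; apply: le_lt_trans.
rewrite -E inE => /orP[->//|/imsetP[x xP ->]].
by rewrite sinvK xP orbT.
Qed.

Lemma profile_anti s : s \in P -> inv s \in P -> degenerate s.
Proof.
case: profP => k /andP[_ /and3P[/and3P[/subsetP sub _ /forall_inP H] _ _]] sP isP.
have /cards1P[x E] := H _ (sub _ sP).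
have /set1P-> : s \in [set x] by rewrite -E !inE sP eqxx.
have : inv s \in [set x] by rewrite -E !inE isP eqxx orbT.
have : s \in [set x] by rewrite -E !inE sP eqxx.
by rewrite !inE /degenerate => /eqP <- /eqP ->.
Qed.

(** The hypothesis on sep excludes r = inv s, a case that consistency does not
control: a profile may contain s although inv s < s. *)
Lemma profile_down r s : s \in P -> r <= s -> sep r != sep s ->
  (sord r <= sord s)%R -> r \in P.
Proof.
move=> sP rs Nrs ors; have /orP[//|irP] := profile_orients sP ors.
case: profP => k /andP[_ /and3P[/and3P[/subsetP sub _ _] /negP[]]].
apply/exists_inP; exists r.
  by have := sub _ irP; rewrite !inE sord_sinv.
apply/exists_inP; exists s; first exact: sub.
rewrite Nrs irP sP lt_neqAle rs !andbT.
by apply: contraNneq Nrs => ->.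
Qed.

Lemma profile_join s t : s \in P -> t \in P -> inv (s `|` t) \notin P.
Proof.
case: profP => k /andP[_ /and3P[_ _ /forall_inP H]] sP tP.
by have /forall_inP := H _ sP; apply.
Qed.

End Profile.

Lemma sep_join_neq s t : ~~ nested_with s t -> sep (s `|` t) != sep t.
Proof.
apply: contraNneq => E; rewrite -(nested_with_sepr _ E) le_nested_with //; exact: leUl.
Qed.

(** Since s and t cross, the join is not an orientation of t, so that consistency
applies to inv (s `|` t) <= inv t in Q. *)
Lemma join_dist s t P Q : profile P -> profile Q -> ~~ nested_with s t ->
  s \in P -> t \in P -> inv t \in Q -> (sord (s `|` t) <= sord t)%R ->
  dist (s `|` t) P Q.
Proof.
move=> pP pQ st sP tP tQ ord.
have stP := profile_join pP sP tP; apply: distI => //.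
  by have := profile_orients pP tP ord; rewrite (negPf stP) orbF.
apply: (profile_down pQ tQ); rewrite ?sinv_leE ?leUr ?sord_sinv //.
by rewrite !sep_inv sep_join_neq.
Qed.

(** The orientation of t is arbitrary: whichever of P and Q contains t also
contains the corner. *)
Lemma efficient_corner s t P Q : profile P -> profile Q -> ~~ nested_with s t ->
  s \in P -> s \in Q -> efficient t P Q -> (sord (s `|` t) <= sord t)%R ->
  efficient (s `|` t) P Q.
Proof.
move=> pP pQ st sP sQ et ord; apply: (efficient_of_dist et) => //.
case/efficientP: et => /andP[_ /orP[]/andP[tP tQ]] _; first exact: join_dist.
by rewrite dist_sym join_dist.
Qed.

Lemma efficient_orients s t P Q : profile P -> profile Q -> efficient t P Q ->
  (sord s <= sord t)%R -> ((s \in P) || (inv s \in P)) && ((s \in Q) || (inv s \in Q)).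
Proof.
move=> pP pQ /efficientP[/andP[_ dt] _] st.
by case/orP: dt => /andP[tP tQ]; rewrite (profile_orients pP tP) ?(profile_orients pQ tQ) ?sord_sinv.
Qed.

Lemma efficient_same_side s t P Q : profile P -> profile Q -> ~~ degenerate s ->
  efficient t P Q -> (sord s <= sord t)%R -> ~~ dist s P Q ->
  exists s', [/\ sep s' = sep s, s' \in P & s' \in Q].
Proof.
move=> pP pQ dg et st; have /andP[] := efficient_orients pP pQ et st.
rewrite /dist dg => /orP[]sP /orP[]sQ; rewrite sP sQ /= ?orbT //.
  by exists s.
by exists (inv s); rewrite sep_inv.
Qed.

Lemma nested_with_inv_inv s t : nested_with (inv s) (inv t) = nested_with s t.
Proof. by rewrite /nested_with !sep_inv. Qed.

(** Used with a and b the orders of opposite corners that cannot have order less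
than k since they would then distinguish a pair of profiles too well. *)
Lemma both_le_of_sum_le (a b k : R) : (a + b <= k + k)%R ->
  ((a <= k)%R -> (k <= a)%R) -> ((b <= k)%R -> (k <= b)%R) ->
  (a <= k)%R /\ (b <= k)%R.
Proof.
move=> ab ak bk; case: (lerP a k) => [/ak|] h; split=> //; first by lra.
  by case: (lerP b k) => [/bk|]; lra.
by case: (lerP b k) => [/bk|]; lra.
Qed.

Lemma efficient_both_corners s t P Q : profile P -> profile Q -> ~~ nested_with s t ->
  efficient s P Q -> sord t = sord s ->
  s \in P -> t \in P -> inv s \in Q -> inv t \in Q ->
  efficient (s `|` t) P Q /\ efficient (s `&` t) P Q.
Proof.
move=> pP pQ st es ots sP tP sQ tQ; case/efficientP: (es) => _ mins.
have djoin : (sord (s `|` t) <= sord s)%R -> dist (s `|` t) P Q.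
  by move=> o; rewrite join_dist // ots.
have dmeet : (sord (s `&` t) <= sord s)%R -> dist (s `&` t) P Q.
  move=> o; rewrite -dist_inv sinv_meet dist_sym join_dist ?sinvK //.
    by rewrite nested_with_inv_inv.
  by rewrite -sinv_meet !sord_sinv ots.
have := sord_submodular s t; rewrite ots => sub.
have [o1 o2] := both_le_of_sum_le sub (fun o => mins _ (djoin o)) (fun o => mins _ (dmeet o)).
by split; apply: (efficient_of_dist es); auto.
Qed.

Lemma dist_orient s P Q : dist s P Q ->
  exists s', [/\ sep s' = sep s, s' \in P & inv s' \in Q].
Proof.
case/andP => _ /orP[]/andP[sP sQ]; [exists s|exists (inv s)] => //.
by rewrite sinvK sep_inv.
Qed.

(** Of two opposite corners that both distinguish P and P', one lies on the side
of s that contains Q and Q', and that corner also distinguishes Q and Q'. *)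
Lemma mixed_corners s t P P' Q Q' :
  profile P -> profile P' -> profile Q -> profile Q' -> ~~ nested_with s t ->
  efficient s P P' -> efficient t Q Q' -> sord s = sord t ->
  dist t P P' -> ~~ dist s Q Q' ->
  exists s' t', [/\ sep s' = sep s, sep t' = sep t,
    efficient (s' `|` t') P P' & efficient (s' `&` t') Q Q'].
Proof.
move=> pP pP' pQ pQ' st es et ost dtP ndsQ.
have dg : ~~ degenerate s by case/efficientP: es => /andP[].
have [|s0 [Es sQ sQ']] := efficient_same_side pQ pQ' dg et _ ndsQ; first by rewrite ost.
have [t0 [Et corners]] : exists t0, sep t0 = sep t /\
    (efficient (s0 `|` t0) P P' /\ efficient (s0 `&` t0) P P').
  have [t1 [Et tP tP']] := dist_orient dtP.
  have st1 t' : sep t' = sep t -> ~~ nested_with s0 t'.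
    by move=> E; rewrite (nested_with_sepl _ Es) (nested_with_sepr _ E).
  have o t' : sep t' = sep t -> sord t' = sord s0.
    by move/sord_sep->; rewrite (sord_sep Es) ost.
  have es0 : efficient s0 P P' by rewrite (efficient_sep _ _ Es).
  case/efficientP: (es0) => /andP[_ /orP[]/andP[sP sP']] _.
    exists t1; split=> //; apply: efficient_both_corners => //; auto.
  have Eit : sep (inv t1) = sep t by rewrite sep_inv.
  exists (inv t1); split=> //; rewrite !(efficient_sym _ P).
  by apply: efficient_both_corners; rewrite ?sinvK 1?efficient_sym; auto.
case: corners => ej em; have ot0 := sord_sep Et.
exists (inv s0), (inv t0); rewrite !sep_inv -sinv_meet -sinv_join !efficient_inv; split=> //.
apply: efficient_corner => //; rewrite ?(efficient_sep _ _ Et) //.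
  by rewrite (nested_with_sepl _ Es) (nested_with_sepr _ Et).
rewrite -(kappaE ej) (kappaE es) ost ot0; exact: lexx.
Qed.

(** In the second alternative P, P' and Q, Q' are distinguished by both s and t,
but may live in complementary pairs of corners, so that no corner need
distinguish Q from Q'.  Then s and t are exchangeable instead, which suffices to
compare crossing numbers. *)
Lemma opposite_corners s t P P' Q Q' :
  profile P -> profile P' -> profile Q -> profile Q' -> ~~ nested_with s t ->
  efficient s P P' -> efficient t Q Q' -> sord s = sord t ->
  exists s' t', [/\ sep s' = sep s, sep t' = sep t &
    (efficient (s' `|` t') P P' /\ efficient (s' `&` t') Q Q') \/
    [/\ efficient (s' `|` t') P P', efficient (s' `&` t') P P',
        efficient t P P' & efficient s Q Q']].
Proof.
move=> pP pP' pQ pQ' st es et ost.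
have ts : ~~ nested_with t s by rewrite nested_with_sym.
have [dtP|ndtP] := boolP (dist t P P'); have [dsQ|ndsQ] := boolP (dist s Q Q').
- have [s' [Es sP sP']] := dist_orient (proj1 (efficientP _ _ _ es)).
  have [t' [Et tP tP']] := dist_orient dtP.
  exists s', t'; split=> //; right.
  have [] : efficient (s' `|` t') P P' /\ efficient (s' `&` t') P P'.
    apply: efficient_both_corners => //.
      by rewrite (nested_with_sepl _ Es) (nested_with_sepr _ Et).
      by rewrite (efficient_sep _ _ Es).
    by rewrite (sord_sep Es) (sord_sep Et).
  by split=> //; [apply: (efficient_of_dist es)|apply: (efficient_of_dist et)]; rewrite // ost.
- have [s' [t' [Es Et ej em]]] := mixed_corners pP pP' pQ pQ' st es et ost dtP ndsQ.
  by exists s', t'; split=> //; left.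
- have [t' [s' [Et Es ej em]]] := mixed_corners pQ pQ' pP pP' ts et es (esym ost) dsQ ndtP.
  exists (inv s'), (inv t'); rewrite !sep_inv -sinv_meet -sinv_join !efficient_inv.
  by rewrite joinC meetC; split=> //; left.
have dgs : ~~ degenerate s by case/efficientP: es => /andP[].
have dgt : ~~ degenerate t by case/efficientP: et => /andP[].
have [|s0 [Es sQ sQ']] := efficient_same_side pQ pQ' dgs et _ ndsQ; first by rewrite ost.
have [|t0 [Et tP tP']] := efficient_same_side pP pP' dgt es _ ndtP; first by rewrite ost.
have os0 := sord_sep Es; have ot0 := sord_sep Et.
exists (inv s0), t0; rewrite sep_inv; split=> //; left.
rewrite -[_ `&` t0]sinvK sinv_meet sinvK efficient_inv.
have st0 : ~~ nested_with s0 t0 by rewrite (nested_with_sepl _ Es) (nested_with_sepr _ Et).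
have ej : (sord (inv s0 `|` t0) <= sord s)%R -> efficient (inv s0 `|` t0) P P'.
  move=> o; rewrite joinC; apply: efficient_corner => //.
  - by rewrite (nested_with_sepr _ (sep_inv _)) nested_with_sym.
  - by rewrite efficient_inv (efficient_sep _ _ Es).
  by rewrite joinC sord_sinv os0.
have em : (sord (s0 `|` inv t0) <= sord s)%R -> efficient (s0 `|` inv t0) Q Q'.
  move=> o; apply: efficient_corner => //.
  - by rewrite (nested_with_sepr _ (sep_inv _)).
  - by rewrite efficient_inv (efficient_sep _ _ Et).
  by rewrite sord_sinv ot0 -ost.
have := sord_submodular s0 (inv t0).
rewrite -(sord_sinv (s0 `&` _)) sinv_meet sinvK sord_sinv os0 ot0 -ost => sub.
case: (both_le_of_sum_le sub) => [/em/kappaE<-|/ej/kappaE<-|o1 o2].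
- by rewrite (kappaE et) ost.
- by rewrite (kappaE es).
by split; auto.
Qed.

(** Let s' be the orientation of s in Q and Q'.  If s' `|` t and s' `|` inv t both
have larger order than t, then s' `&` t and s' `&` inv t have smaller order than
s.  The one of P and P' that contains s' contains them by consistency; the other
one also contains them, by the minimality of the order of s, contrary to its
robustness. *)
Lemma robust_corner (n : R) s t P P' Q Q' :
  profile P -> profile P' -> profile Q -> profile Q' -> ~~ nested_with s t ->
  efficient s P P' -> efficient t Q Q' -> (sord s < sord t)%R -> (sord t < n)%R ->
  robust_profile n (P :&: Sk U (sord s + 1)%R) ->
  robust_profile n (P' :&: Sk U (sord s + 1)%R) ->
  exists s' t', [/\ sep s' = sep s, sep t' = sep t & efficient (s' `|` t') Q Q'].
Proof.
move=> pP pP' pQ pQ' st es et ost otn rP rP'.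
have dg : ~~ degenerate s by case/efficientP: es => /andP[].
have ndsQ : ~~ dist s Q Q'.
  by apply/negP => /(proj2 (efficientP _ _ _ et)); rewrite leNgt ost.
have [|s0 [Es sQ sQ']] := efficient_same_side pQ pQ' dg et _ ndsQ; first exact: ltW.
have os0 := sord_sep Es.
have small_corner t' : sep t' = sep t -> (sord (s0 `|` t') <= sord t)%R ->
    efficient (s0 `|` t') Q Q'.
  move=> Et o; apply: efficient_corner; rewrite // ?(efficient_sep _ _ Et) ?(sord_sep Et) //.
  by rewrite (nested_with_sepl _ Es) (nested_with_sepr _ Et).
have [o1|o1] := lerP (sord (s0 `|` t)) (sord t).
  by exists s0, t; split; auto.
have [o2|o2] := lerP (sord (s0 `|` inv t)) (sord t).
  by exists s0, (inv t); split; rewrite ?sep_inv //; apply: small_corner; rewrite ?sep_inv.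
have m1 : (sord (s0 `&` t) < sord s0)%R by have := sord_submodular s0 t; lra.
have m2 : (sord (s0 `&` inv t) < sord s0)%R.
  by have := sord_submodular s0 (inv t); rewrite sord_sinv; lra.
(* X is the profile whose robustness is violated. *)
have key X Y : profile X -> profile Y -> efficient s X Y -> s0 \in Y -> inv s0 \in X ->
    robust_profile n (X :&: Sk U (sord s + 1)%R) -> False.
  move=> pX pY eXY sY sX rX.
  have inX t' : sep t' = sep t -> (sord (s0 `&` t') < sord s0)%R ->
      s0 `&` t' \in X :&: Sk U (sord s + 1)%R.
    move=> Et o; rewrite !inE; apply/andP; split; last by lra.
    have /orP[//|iX] : (s0 `&` t' \in X) || (inv (s0 `&` t') \in X).
      by apply: (profile_orients pX sX); rewrite sord_sinv ltW.
    have inY : s0 `&` t' \in Y.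
      apply: (profile_down pY sY); rewrite ?leIl ?(ltW o) //.
      rewrite -sep_inv sinv_meet joinC -(sep_inv s0) sep_join_neq //.
      rewrite nested_with_inv_inv nested_with_sym.
      by rewrite (nested_with_sepl _ Es) (nested_with_sepr _ Et).
    have [//|nX] := boolP (s0 `&` t' \in X).
    have : dist (s0 `&` t') X Y.
      by rewrite -dist_inv; apply: distI; rewrite ?sinvK.
    by move/(proj2 (efficientP _ _ _ eXY)); rewrite leNgt -os0 o.
  apply: (rX (inv s0) t); rewrite ?sinvK ?sord_sinv //.
  - by rewrite !inE sX sord_sinv; lra.
  - by rewrite inE.
  by split; apply: inX; rewrite // sep_inv.
have : efficient s0 P P' by rewrite (efficient_sep _ _ Es).
case/efficientP => /andP[_ /orP[]/andP[sP sP']] _.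
  by case: (key P' P) => //; rewrite efficient_sym.
by case: (key P P').
Qed.

(** * The layers of the canonical set *)

(** The rank of the order of s among the finitely many orders that occur; it
replaces the real number sord s in the recursion. *)
Definition order_rank s : nat := #|Sk U (sord s)|.

Lemma order_rank_lt s t : (order_rank s < order_rank t)%N = (sord s < sord t)%R.
Proof.
have [st|ts] := ltP (sord s) (sord t).
  apply: proper_card; apply/properP; split.
    by apply/subsetP => u; rewrite !inE => /lt_trans; apply.
  by exists s; rewrite !inE ?ltxx.
rewrite ltnNge; apply/negbF/subset_leq_card/subsetP => u; rewrite !inE.
by move/lt_le_trans; apply.
Qed.

Lemma order_rank_inj s t : order_rank s = order_rank t -> sord s = sord t.
Proof. by move=> E; apply/le_anti; rewrite !leNgt -!order_rank_lt E ltnn. Qed.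

Definition candidates n A P Q : {set U} :=
  [set s | [&& efficient s P Q, order_rank s == n & [forall u in A, nested_with u s]]].

Definition new_candidates Ps n A : {set U} :=
  [set s | [exists P in Ps, exists Q in Ps, s \in candidates n A P Q]].

Definition least_crossing Ps n A P Q : {set U} :=
  [set s in candidates n A P Q | [forall s' in candidates n A P Q,
     (crossing_number (new_candidates Ps n A) s
      <= crossing_number (new_candidates Ps n A) s')%N]].

Definition new_layer Ps n A : {set U} :=
  [set s | [exists P in Ps, exists Q in Ps, s \in least_crossing Ps n A P Q]].

Fixpoint layer Ps n : {set U} :=
  if n is m.+1 then layer Ps m :|: new_layer Ps m (layer Ps m) else set0.

(** All ranks are at most #|U|, so that layer Ps #|U|.+1 contains every layer. *)
Definition canonical_tree Ps : {set {set U}} := [set sep s | s in layer Ps #|U|.+1].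

Lemma candidatesP n A P Q s :
  reflect [/\ efficient s P Q, order_rank s = n & {in A, forall u, nested_with u s}]
          (s \in candidates n A P Q).
Proof.
rewrite inE; apply: (iffP and3P) => -[? E H]; split=> //; try exact/eqP.
  exact/forall_inP.
exact/forall_inP.
Qed.

Lemma candidates_sep n A P Q s t : sep s = sep t ->
  (s \in candidates n A P Q) = (t \in candidates n A P Q).
Proof.
move=> E; rewrite !inE (efficient_sep _ _ E) /order_rank (sord_sep E).
by under eq_forallb do rewrite (nested_with_sepr _ E).
Qed.

Lemma new_candidatesP Ps n A s :
  reflect (exists P Q, [/\ P \in Ps, Q \in Ps & s \in candidates n A P Q])
          (s \in new_candidates Ps n A).
Proof.
rewrite inE; apply: (iffP exists_inP) => [[P PPs /exists_inP[Q QPs ?]]|[P [Q [PPs QPs ?]]]].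
  by exists P, Q.
by exists P => //; apply/exists_inP; exists Q.
Qed.

Lemma new_layerP Ps n A s :
  reflect (exists P Q, [/\ P \in Ps, Q \in Ps & s \in least_crossing Ps n A P Q])
          (s \in new_layer Ps n A).
Proof.
rewrite inE; apply: (iffP exists_inP) => [[P PPs /exists_inP[Q QPs ?]]|[P [Q [PPs QPs ?]]]].
  by exists P, Q.
by exists P => //; apply/exists_inP; exists Q.
Qed.

(** The corners from opposite_corners are candidates, by the fish lemma.  One of
them replaces s and the other t, or both replace s while s and t have equal
crossing numbers; either way strict submodularity contradicts minimality. *)
Lemma new_layer_nested Ps n A s t : {in Ps, forall P, profile P} ->
  s \in new_layer Ps n A -> t \in new_layer Ps n A -> nested_with s t.
Proof.
move=> prof /new_layerP[P [P' [PPs PPs']]] + /new_layerP[Q [Q' [QPs QPs']]].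
set N := new_candidates Ps n A.
rewrite inE => /andP[cs /forall_inP mins]; rewrite inE => /andP[ct /forall_inP mint].
apply: contraT => st; case/candidatesP: (cs) => es ls As; case/candidatesP: (ct) => et lt At.
have ost : sord s = sord t by apply: order_rank_inj; rewrite ls lt.
have [s' [t' [Es Et H]]] := opposite_corners (prof _ PPs) (prof _ PPs')
  (prof _ QPs) (prof _ QPs') st es et ost.
have st' : ~~ nested_with s' t' by rewrite (nested_with_sepl _ Es) (nested_with_sepr _ Et).
have cj X Y : order_rank (s' `|` t') = n -> efficient (s' `|` t') X Y ->
    s' `|` t' \in candidates n A X Y.
  move=> l e; apply/candidatesP; split=> // u uA; rewrite nested_with_join //.
    by rewrite (nested_with_sepr _ Es) As.
  by rewrite (nested_with_sepr _ Et) At.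
have cm X Y : order_rank (s' `&` t') = n -> efficient (s' `&` t') X Y ->
    s' `&` t' \in candidates n A X Y.
  move=> l e; apply/candidatesP; split=> // u uA; rewrite nested_with_meet //.
    by rewrite (nested_with_sepr _ Es) As.
  by rewrite (nested_with_sepr _ Et) At.
have lP c : efficient c P P' -> order_rank c = n.
  by move/kappaE=> E; rewrite /order_rank -E (kappaE es).
have lQ c : efficient c Q Q' -> order_rank c = n.
  by move/kappaE=> E; rewrite /order_rank -E (kappaE et).
have : (crossing_number N (s' `|` t') + crossing_number N (s' `&` t')
        < crossing_number N s' + crossing_number N t')%N.
  apply: crossing_number_submodular => //; apply/new_candidatesP; exists P, P'; split=> //.
  by rewrite (candidates_sep _ _ _ _ Es).
rewrite (crossing_number_sep _ Es) (crossing_number_sep _ Et) ltnNge => /negP[].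
case: H => [[ej em]|[ej em etP esQ]].
  by apply: leq_add; [apply: mins; apply: cj; rewrite ?lP|apply: mint; apply: cm; rewrite ?lQ].
have tP : t \in candidates n A P P' by apply/candidatesP.
have sQ : s \in candidates n A Q Q' by apply/candidatesP.
have -> : crossing_number N t = crossing_number N s by apply/eqP; rewrite eqn_leq mint // mins.
by apply: leq_add; apply: mins; [apply: cj|apply: cm]; rewrite ?lP.
Qed.

(** * Robust sets of profiles *)

Section RobustSet.
Variables (Ps : {set {set U}}) (n : R).
Hypothesis prof : {in Ps, forall P, profile P}.
Hypothesis robust : n_robust_set n Ps.

Lemma efficient_neq s P Q : profile P -> efficient s P Q -> P != Q.
Proof.
move=> pP /efficientP[/andP[/negP dg H] _]; apply/eqP => E; apply: dg.
by subst Q; case/orP: H => /andP[sP isP]; apply: (profile_anti pP).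
Qed.

(** Uncrossing an efficient distinguisher from the previous layers.  A corner
given by robust_corner crosses fewer elements of A: it is nested with u, and
also with all those with which t is nested, because A is nested. *)
Lemma candidates_nonempty m A P Q s :
  (forall u v, u \in A -> v \in A -> nested_with u v) ->
  (forall u, u \in A -> exists P Q, [/\ P \in Ps, Q \in Ps & efficient u P Q]) ->
  (forall u, u \in A -> (order_rank u < m)%N) ->
  P \in Ps -> Q \in Ps -> efficient s P Q -> order_rank s = m ->
  exists t, t \in candidates m A P Q.
Proof.
move=> An Ae Al PPs QPs es ls.
case: (@arg_minnP _ s (fun t => efficient t P Q) (crossing_number A) es) => t et mint.
have lt : order_rank t = m by rewrite /order_rank -(kappaE et) (kappaE es).
exists t; apply/candidatesP; split=> // u uA; apply: contraT => ut.
have [X [Y [XPs YPs eu]]] := Ae _ uA.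
have [[_ rX rY] _] := robust XPs YPs (efficient_neq (prof XPs) eu).
have [_ tn] := robust PPs QPs (efficient_neq (prof PPs) et).
rewrite (kappaE eu) in rX rY; rewrite (kappaE et) in tn.
have out : (sord u < sord t)%R by rewrite -order_rank_lt lt Al.
have [u' [t' [Eu Et e]]] := robust_corner (prof XPs) (prof YPs) (prof PPs)
  (prof QPs) ut eu et out tn rX rY.
have := mint _ e; rewrite leqNgt -(crossing_number_sep _ Et) => /negP[].
have ut' : ~~ nested_with u' t' by rewrite (nested_with_sepl _ Eu) (nested_with_sepr _ Et).
apply: proper_card; apply/properP; split.
  apply/subsetP => v; rewrite !inE => /andP[vA vc]; rewrite vA /=.
  apply: contra vc => vt; apply: nested_with_join => //.
  by rewrite (nested_with_sepr _ Eu) An.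
exists u; rewrite !inE uA /= ?(nested_with_sepr _ Et) //.
by rewrite negbK -(nested_with_sepl _ Eu) le_nested_with ?leUl.
Qed.

Lemma layer_efficient m s : s \in layer Ps m ->
  exists P Q, [/\ P \in Ps, Q \in Ps & efficient s P Q].
Proof.
elim: m => [|m IH] /=; first by rewrite inE.
rewrite inE => /orP[//|/new_layerP[P [Q [PPs QPs]]]].
by rewrite inE => /andP[/candidatesP[e _ _] _]; exists P, Q.
Qed.

Lemma layer_order_rank m s : s \in layer Ps m -> (order_rank s < m)%N.
Proof.
elim: m => [|m IH] /=; first by rewrite inE.
rewrite inE => /orP[/IH/ltnW //|/new_layerP[P [Q [PPs QPs]]]].
by rewrite inE => /andP[/candidatesP[_ -> _] _].
Qed.

Lemma layer_nested m s t :
  s \in layer Ps m -> t \in layer Ps m -> nested_with s t.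
Proof.
elim: m => [|m IH] /= in s t *; first by rewrite inE.
have old_new u v : u \in layer Ps m -> v \in new_layer Ps m (layer Ps m) ->
    nested_with u v.
  move=> uA /new_layerP[P [Q [_ _]]]; rewrite inE => /andP[/candidatesP[_ _ H] _].
  exact: H.
rewrite !in_setU => /orP[] sA /orP[] tA; first exact: IH.
- exact: old_new.
- by rewrite nested_with_sym old_new.
exact: (new_layer_nested prof sA tA).
Qed.

Lemma layer_sub m p : (m <= p)%N -> {subset layer Ps m <= layer Ps p}.
Proof.
move/subnK <-; elim: (p - m)%N => // k IH s /IH; rewrite addSn /= inE => -> //.
Qed.

Lemma layer_distinguishes P Q : P \in Ps -> Q \in Ps -> P != Q ->
  exists2 s, s \in layer Ps #|U|.+1 & efficient s P Q.
Proof.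
move=> PPs QPs PQ; have [[dPQ _ _] _] := robust PPs QPs PQ.
have [s es] := efficient_exists dPQ.
have [t ct] := candidates_nonempty (@layer_nested (order_rank s))
  (@layer_efficient (order_rank s))
  (@layer_order_rank (order_rank s)) PPs QPs es erefl.
set N := new_candidates Ps (order_rank s) (layer Ps (order_rank s)).
case: (@arg_minnP _ t (fun u => u \in candidates (order_rank s) (layer Ps (order_rank s)) P Q)
  (crossing_number N) ct) => u cu minu.
exists u; last by case/candidatesP: cu.
apply: (@layer_sub (order_rank s).+1); first by rewrite ltnS max_card.
rewrite /= inE; apply/orP; right; apply/new_layerP; exists P, Q; split=> //.
by rewrite inE cu; apply/forall_inP.
Qed.

End RobustSet.

(** * Invariance under automorphisms *)

Section Automorphism.
Variable a : U -> U.
Hypothesis aut : automorphism a.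

Lemma aut_inj : injective a.
Proof. by case: aut => /bij_inj. Qed.

Lemma aut_sord s : sord (a s) = sord s.
Proof. by case: aut. Qed.

Lemma aut_inv s : a (inv s) = inv (a s).
Proof. by case: aut. Qed.

Lemma aut_sep s : sep (a s) = a @: sep s.
Proof. by rewrite /sep imsetU1 imset_set1 aut_inv. Qed.

Lemma aut_surj s : exists t, s = a t.
Proof. by case: aut => -[b _ bK] _ _ _; exists (b s); rewrite bK. Qed.

Lemma forall_aut (F : pred U) : [forall s, F s] = [forall s, F (a s)].
Proof.
apply/forallP/forallP => H s; first exact: H.
by have [t ->] := aut_surj s.
Qed.

Lemma aut_nested_with s t : nested_with (a s) (a t) = nested_with s t.
Proof.
have [_ le _ _] := aut.
apply/nested_withP/nested_withP => -[u Eu H].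
  have [v E] := aut_surj u; subst u; exists v; last by rewrite !le in H.
  by move: Eu; rewrite !aut_sep => /imset_inj; apply; apply: aut_inj.
by exists (a u); rewrite ?le ?aut_sep ?Eu.
Qed.

Lemma aut_mem s A : (a s \in a @: A) = (s \in A).
Proof. exact: mem_imset aut_inj. Qed.

Lemma aut_efficient s P Q : efficient (a s) (a @: P) (a @: Q) = efficient s P Q.
Proof.
have D t : dist (a t) (a @: P) (a @: Q) = dist t P Q.
  by rewrite /dist /degenerate -aut_inv !aut_mem (inj_eq aut_inj).
rewrite /efficient D forall_aut; congr (_ && _).
by apply: eq_forallb => t; rewrite D !aut_sord.
Qed.

Lemma aut_order_rank s : order_rank (a s) = order_rank s.
Proof. by rewrite /order_rank aut_sord. Qed.

Lemma aut_candidates n A P Q s :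
  (a s \in candidates n (a @: A) (a @: P) (a @: Q)) = (s \in candidates n A P Q).
Proof.
rewrite !inE aut_efficient aut_order_rank forall_aut; congr [&& _, _ & _].
by apply: eq_forallb => u; rewrite aut_mem aut_nested_with.
Qed.

Lemma aut_set A N : (forall s, (a s \in N) = (s \in A)) -> N = a @: A.
Proof.
move=> H; apply/setP => s; have [t ->] := aut_surj s.
by rewrite H aut_mem.
Qed.

Lemma aut_new_candidates Ps n A :
  new_candidates (image_family a Ps) n (a @: A) = a @: new_candidates Ps n A.
Proof.
apply: aut_set => s; apply/new_candidatesP/new_candidatesP.
  case=> _ [_ [/imsetP[P PPs ->] /imsetP[Q QPs ->]]].
  by rewrite aut_candidates; exists P, Q.
case=> P [Q [PPs QPs ?]]; exists (a @: P), (a @: Q).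
by rewrite aut_candidates; split=> //; apply: imset_f.
Qed.

Lemma aut_crossing_number N s :
  crossing_number (a @: N) (a s) = crossing_number N s.
Proof.
rewrite /crossing_number -[RHS](card_imset _ aut_inj).
have <- : [set u in a @: N | ~~ nested_with u (a s)] = a @: [set u in N | ~~ nested_with u s].
  by apply: aut_set => u; rewrite !inE aut_mem aut_nested_with.
by [].
Qed.

Lemma aut_least_crossing Ps n A P Q s :
  (a s \in least_crossing (image_family a Ps) n (a @: A) (a @: P) (a @: Q)) =
  (s \in least_crossing Ps n A P Q).
Proof.
rewrite [LHS]inE [RHS]inE aut_candidates aut_new_candidates forall_aut.
congr andb; apply: eq_forallb => t.
by rewrite aut_candidates !aut_crossing_number.
Qed.

Lemma aut_new_layer Ps n A :
  new_layer (image_family a Ps) n (a @: A) = a @: new_layer Ps n A.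
Proof.
apply: aut_set => s; apply/new_layerP/new_layerP.
  case=> _ [_ [/imsetP[P PPs ->] /imsetP[Q QPs ->]]].
  by rewrite aut_least_crossing; exists P, Q.
case=> P [Q [PPs QPs ?]]; exists (a @: P), (a @: Q).
by rewrite aut_least_crossing; split=> //; apply: imset_f.
Qed.

Lemma aut_layer Ps n : layer (image_family a Ps) n = a @: layer Ps n.
Proof.
by elim: n => [|n IH] /=; rewrite ?imset0 // imsetU -aut_new_layer IH.
Qed.

Lemma aut_canonical_tree Ps :
  canonical_tree (image_family a Ps) = image_family a (canonical_tree Ps).
Proof.
rewrite /canonical_tree aut_layer /image_family -!imset_comp.
by apply: eq_imset => s /=; rewrite aut_sep.
Qed.

End Automorphism.

Lemma efficient_regular s P Q : regular_profile P -> regular_profile Q ->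
  efficient s P Q -> ~~ small s && ~~ small (inv s).
Proof.
move=> /forall_inP rP /forall_inP rQ /efficientP[/andP[_ H] _].
by case/orP: H => /andP[/rP + /rQ]; rewrite sinvK => -> ->.
Qed.

End TreeOfProfiles.

(** * The canonical nested set *)

Theorem theorem3p6 (R : realType) (d : Order.disp_t)
    (U : finSubmodUniverseType R d) :
  exists T : {set {set U}} -> {set {set U}},
    forall Ps : {set {set U}}, robust_set_of_profiles Ps ->
      [/\ T Ps \subset separations U /\ nested (T Ps),
          (forall P P', P \in Ps -> P' \in Ps -> P != P' ->
             exists2 t, t \in T Ps & efficiently_distinguishes t P P'),
          (forall t, t \in T Ps ->
             exists P P', [/\ P \in Ps, P' \in Ps
               & efficiently_distinguishes t P P']),
          (forall a : U -> U, automorphism a ->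
             T (image_family a Ps) = image_family a (T Ps))
        & ((forall P, P \in Ps -> regular_profile P) ->
             regular_tree_set (T Ps))].
Proof.
exists (@canonical_tree R d U) => Ps [prof _ robust].
have sub : canonical_tree Ps \subset separations U.
  by apply/subsetP => _ /imsetP[s _ ->]; apply: imset_f.
have nest : nested (canonical_tree Ps).
  apply/forall_inP => _ /imsetP[s sT ->]; apply/forall_inP => _ /imsetP[t tT ->].
  exact: (layer_nested prof sT tT).
split=> //.
- move=> P P' PPs PPs' PP'.
  have [s sT es] := layer_distinguishes prof robust PPs PPs' PP'.
  by exists (sep s); [apply: imset_f|apply: efficient_efficiently_distinguishes].
- move=> _ /imsetP[s sT ->]; have [P [Q [PPs QPs es]]] := layer_efficient sT.
  by exists P, Q; split=> //; apply: efficient_efficiently_distinguishes.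
- by move=> a aut; apply: aut_canonical_tree.
move=> reg; have nsmall s : s \in cover (canonical_tree Ps) -> ~~ small s.
  case/bigcupP => _ /imsetP[t tT ->].
  have [P [Q [PPs QPs es]]] := layer_efficient tT.
  have /andP[n1 n2] := efficient_regular (reg _ PPs) (reg _ QPs) es.
  by rewrite !inE => /orP[]/eqP->.
apply/andP; split; last exact/forall_inP.
rewrite /tree_set sub nest /=; apply/forall_inP => s /nsmall ns.
apply/andP; split; apply: contra ns.
  by rewrite /degenerate /small => /eqP <-; apply: lexx.
(* If t witnesses that s is trivial, then s <= t and t <= inv s. *)
case/exists_inP => t _ /andP[/ltW st /ltW sit].
by apply: le_trans st _; rewrite -[t]sinvK; apply: sinv_le.
Qed.
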